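(* (Normal form) For each integer $n\ge 3$ and each element $X\in S_n^+$ there exist integers $k_1,\dots,k_{n-2}$ such that $0\le k_j\le j+1$ for $j=1,\dots,n-2$, and the element $X$ has a representation of the form $$X=y_{1,k_1}\cdot y_{2,k_2}\cdots y_{n-2,k_{n-2}}.$$ In particular, $x_{n-2}$ appears in that form at most once, and the generator $x_{n-k}$ appears at most $k-1$ times, $k=2,\dots,n-1$.
   Context: For an integer $n\ge 2$, $S_n^+$ denotes the group given by generators $x_1,\dots,x_{n-2}$ and the defining relations (R1) $x_i^3=1$ for $i=1,\dots,n-2$; (R2) $(x_i x_{i+1})^2=1$ for $i=1,\dots,n-3$; (R3) $x_i x_j=x_j x_i$ for $i,j=1,\dots,n-2$ with $|i-j|>2$; (R4) $x_i x_{i+1}^{-1} x_{i+2}=x_{i+2}x_i$ for $i=1,\dots,n-4$. (A family of relations with empty index range is vacuous.) For $1\le m\le n-2$ define the following elements of $S_n^+$: $y_{m,0}=x_m x_{m-1}\cdots x_2 x_1^2$; $y_{m,k}=x_m x_{m-1}\cdots x_k$ for $k=1,\dots,m$; $y_{m,m+1}=\mathrm{id}$. In particular, $y_{1,0}=x_1^2$, $y_{1,1}=x_1$, $y_{1,2}=\mathrm{id}$. *)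

(* Defs.v *)
From HB Require Import structures.
From mathcomp Require Import all_boot.
From mathcomp Require Import boolp.

Set Implicit Arguments.
Unset Strict Implicit.
Unset Printing Implicit Defensive.

(* The letter (t, false) is the generator t, and (t, true) is its inverse.  *)
Definition word (T : Type) := seq (T * bool).

Definition inv_letter (T : Type) (a : T * bool) : T * bool := (a.1, ~~ a.2).

Definition inv_word (T : Type) (w : word T) : word T :=
  rev (map (@inv_letter T) w).

Lemma inv_wordK (T : Type) : involutive (@inv_word T).
Proof.
move=> w; rewrite /inv_word map_rev revK -map_comp -[RHS]map_id.
by apply: eq_map => -[t b]; rewrite /inv_letter /= negbK.
Qed.

Section Presentation.
Variables (T : choiceType) (rel : word T -> word T -> Prop).

(* The smallest congruence on words that contains rel and makes t and t^-1
   inverse to each other: its classes are the elements of < T | rel >.      *)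
Inductive pcongr : word T -> word T -> Prop :=
| pcongr_refl u : pcongr u u
| pcongr_sym u v : pcongr u v -> pcongr v u
| pcongr_trans u v w : pcongr u v -> pcongr v w -> pcongr u w
| pcongr_cat u u' v v' : pcongr u u' -> pcongr v v' ->
    pcongr (u ++ v) (u' ++ v')
| pcongr_cancel a : pcongr [:: a; inv_letter a] [::]
| pcongr_rel u v : rel u v -> pcongr u v.

Lemma pcongr_mulV w : pcongr (w ++ inv_word w) [::].
Proof.
elim: w => [|a w IHw]; first exact: pcongr_refl.
have -> : (a :: w) ++ inv_word (a :: w) =
    [:: a] ++ ((w ++ inv_word w) ++ [:: inv_letter a]).
  by rewrite /inv_word /= rev_cons -cats1 !catA.
apply: pcongr_trans (pcongr_cancel a).
apply: (@pcongr_cat [:: a] [:: a] _ [:: inv_letter a] (pcongr_refl _)).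
exact: pcongr_cat IHw (pcongr_refl _).
Qed.

Lemma pcongr_Vmul w : pcongr (inv_word w ++ w) [::].
Proof. by have := pcongr_mulV (inv_word w); rewrite inv_wordK. Qed.

Lemma pcongr_inv u v : pcongr u v -> pcongr (inv_word u) (inv_word v).
Proof.
move=> uv; have Dv : pcongr (inv_word u) (inv_word u ++ (v ++ inv_word v)).
  rewrite -[X in pcongr X _]cats0; apply: pcongr_cat (pcongr_refl _) _.
  exact/pcongr_sym/pcongr_mulV.
apply: pcongr_trans Dv _; rewrite catA -[X in pcongr _ X]cat0s.
apply: pcongr_cat (pcongr_refl _); apply: pcongr_trans (pcongr_Vmul u).
exact: pcongr_cat (pcongr_refl _) (pcongr_sym uv).
Qed.

Definition pcongrb (u v : word T) : bool := `[< pcongr u v >].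

Lemma pcongrb_refl : reflexive pcongrb.
Proof. by move=> u; apply/asboolP; apply: pcongr_refl. Qed.

Lemma pcongrb_sym : symmetric pcongrb.
Proof. by move=> u v; apply/asboolP/asboolP; apply: pcongr_sym. Qed.

Lemma pcongrb_trans : transitive pcongrb.
Proof.
move=> v u w /asboolP uv /asboolP vw; apply/asboolP.
exact: pcongr_trans uv vw.
Qed.

Canonical pcongr_equiv :=
  EquivRel pcongrb pcongrb_refl pcongrb_sym pcongrb_trans.

Local Open Scope quotient_scope.

Definition presented : Type := {eq_quot pcongr_equiv}.

HB.instance Definition _ := Choice.on presented.
HB.instance Definition _ := EqQuotient.on presented.

Definition pclass (w : word T) : presented := \pi_presented w.

Lemma pclassP u v : pclass u = pclass v <-> pcongr u v.
Proof.
split=> [/eqP | uv]; last by apply/eqmodP/asboolP.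
by rewrite eqmodE => /asboolP.
Qed.

Lemma pclass_surj (a : presented) : exists w, a = pclass w.
Proof. by exists (repr a); rewrite /pclass reprK. Qed.

Lemma repr_pclass w : pcongr (repr (pclass w)) w.
Proof. by apply/pclassP; rewrite /pclass reprK. Qed.

Definition pone : presented := pclass [::].
Definition pmul (a b : presented) : presented := pclass (repr a ++ repr b).
Definition pinv (a : presented) : presented := pclass (inv_word (repr a)).

Lemma pmul_pclass u v : pmul (pclass u) (pclass v) = pclass (u ++ v).
Proof. by apply/pclassP; apply: pcongr_cat; apply: repr_pclass. Qed.

Lemma pinv_pclass u : pinv (pclass u) = pclass (inv_word u).
Proof. exact/pclassP/pcongr_inv/repr_pclass. Qed.

Lemma pmulA : associative pmul.
Proof.
move=> a b c; have [u ->] := pclass_surj a; have [v ->] := pclass_surj b.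
by have [w ->] := pclass_surj c; rewrite !pmul_pclass catA.
Qed.

Lemma pmul1p : left_id pone pmul.
Proof. by move=> a; have [u ->] := pclass_surj a; rewrite pmul_pclass. Qed.

Lemma pmulp1 : right_id pone pmul.
Proof.
by move=> a; have [u ->] := pclass_surj a; rewrite pmul_pclass cats0.
Qed.

Lemma pmulVp : left_inverse pone pinv pmul.
Proof.
move=> a; have [w ->] := pclass_surj a; rewrite pinv_pclass pmul_pclass.
exact/pclassP/pcongr_Vmul.
Qed.

Lemma pmulpV : right_inverse pone pinv pmul.
Proof.
move=> a; have [w ->] := pclass_surj a; rewrite pinv_pclass pmul_pclass.
exact/pclassP/pcongr_mulV.
Qed.

HB.instance Definition _ :=
  isGroup.Build presented pmulA pmul1p pmulp1 pmulVp pmulpV.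

Definition pgen (t : T) : presented := pclass [:: (t, false)].

End Presentation.

Definition gen (n : nat) : Type := {i : nat | 0 < i <= n - 2}.

Definition letter (n : nat) (i : gen n) : word (gen n) := [:: (i, false)].

(* The subtractions in R3 are truncated, so exactly |i - j| > 2 is asked.   *)
Inductive S_plus_rel (n : nat) : word (gen n) -> word (gen n) -> Prop :=
| S_plus_R1 i : S_plus_rel (letter i ++ letter i ++ letter i) [::]
| S_plus_R2 i j : val j = val i + 1 ->
    S_plus_rel (letter i ++ letter j ++ letter i ++ letter j) [::]
| S_plus_R3 i j : 2 < val i - val j \/ 2 < val j - val i ->
    S_plus_rel (letter i ++ letter j) (letter j ++ letter i)
| S_plus_R4 i j k : val j = val i + 1 -> val k = val i + 2 ->
    S_plus_rel (letter i ++ inv_word (letter j) ++ letter k)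
               (letter k ++ letter i).

Definition S_plus (n : nat) : groupType := presented (@S_plus_rel n).

(* The generator x_i; the value 1 is only taken outside 1 <= i <= n - 2.    *)
Definition x_ (n i : nat) : S_plus n :=
  if insub i is Some t then pgen (@S_plus_rel n) t else 1%g.

(* Formal products of powers of generators: (i, e) stands for x_i ^ e, and
   such a factor is one appearance of x_i whatever e is.  In particular the
   factor x_1^2 of y_{m,0} is one appearance of x_1: counting it twice would
   make the bound on appearances of x_1 fail already for n = 3, X = x_1^2.  *)
Definition form := seq (nat * nat).

Definition form_value (n : nat) (f : form) : S_plus n :=
  (\prod_(s <- f) x_ n s.1 ^+ s.2)%g.

Definition appearances (i : nat) (f : form) : nat :=
  count (fun s => s.1 == i) f.

(* x_m x_(m-1) ... x_k, empty when k = m + 1 *)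
Definition descending (m k : nat) : form :=
  [seq (i, 1) | i <- rev (index_iota k m.+1)].

Definition y_form (m k : nat) : form :=
  if k == 0 then descending m 2 ++ [:: (1, 2)] else descending m k.

Definition y_ (n m k : nat) : S_plus n := form_value n (y_form m k).

Definition normal_form (n : nat) (k : nat -> nat) : form :=
  flatten [seq y_form j (k j) | j <- index_iota 1 (n - 1)].

(* Main.v *)
(* Let H_m be the subgroup generated by x_1, ..., x_m.  It suffices that
   y_{m,k} x_i always lies in H_{m-1} y_{m,k'} for some k': induction on m then
   gives H_m = H_{m-1} {y_{m,0}, ..., y_{m,m+1}}.  Here x_i stands for the
   3-cycle i+2 -> i+1 -> i -> i+2, and the coset H_{m-1} y_{m,k} for the image
   k+1 of the point m+2; so k' = i, i-1, i+1 for k = i+1, i, i-1, and k' = k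
   otherwise.  By R3 and R4, x_m conjugates H_{m-2} into H_{m-1}, hence
   x_m ... x_{j+2} conjugates H_j into H_{m-1}.  This reduces every case to one
   of a few identities between at most three consecutive generators a, b, c. *)

Require Import Defs.
From mathcomp Require Import all_boot.
From mathcomp Require Import zify.

Set Implicit Arguments.
Unset Strict Implicit.
Unset Printing Implicit Defensive.

Local Open Scope group_scope.

(** * Identities between consecutive generators a, b, c *)

Section ThreeCycleIdentities.
Variable G : groupType.
Implicit Types a b c : G.

Lemma expg2_inv a : a ^+ 3 = 1 -> a ^+ 2 = a^-1.
Proof. by move=> a3; apply: (mulgI a); rewrite mulgV -expgS. Qed.

Lemma mul_aba a b : (a * b) ^+ 2 = 1 -> a * b * a = b^-1.
Proof. by move=> ab2; apply: (mulIg b); rewrite mulVg -ab2 expgS !mulgA. Qed.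

Lemma mul_bab a b : (a * b) ^+ 2 = 1 -> b * a * b = a^-1.
Proof. by move=> ab2; apply: (mulgI a); rewrite mulgV -ab2 expgS !mulgA. Qed.

Lemma mul_ba a b : (a * b) ^+ 2 = 1 -> b * a = a^-1 * b^-1.
Proof. by move/mul_aba=> <-; rewrite -mulgA mulKg. Qed.

(** Replacing each a^-1 on the right by b a b leaves b^3 in the middle. With a = x_1 and b = x_2
    this computes y_{2,0} x_2. *)
Lemma mul_baab a b :
  b ^+ 3 = 1 -> a ^+ 3 = 1 -> (a * b) ^+ 2 = 1 ->
  b * a ^+ 2 * b = a^-1 * b * a ^+ 2.
Proof.
move=> b3 a3 ab2; have b3' : b * b * b = 1 by rewrite -mulgA -b3.
rewrite [in RHS]expg2_inv // -[in RHS](mul_bab ab2) -!mulgA.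
by rewrite (mulgA b b) (mulgA (b * b)) b3' mul1g !mulgA.
Qed.

(** Both sides equal c a c a: R2 rewrites b a and c b as products of inverses, then R4 eliminates
    b. *)
Lemma mul_cbac a b c :
  a ^+ 3 = 1 -> c ^+ 3 = 1 -> (a * b) ^+ 2 = 1 -> (b * c) ^+ 2 = 1 ->
  a * b^-1 * c = c * a -> c * b * a * c = a * c * b * a.
Proof.
move=> a3 c3 ab2 bc2 abc.
have Dbc : b^-1 * c = a^-1 * c * a by rewrite -mulgA -abc -mulgA mulKg.
rewrite -(mulgA c) (mul_ba ab2) -[a * c * b]mulgA (mul_ba bc2).
rewrite -(expg2_inv c3) !mulgA abc -(mulgA _ _ c) Dbc !mulgA.
by rewrite -(mulgA c) -invgM (expg2_inv a3 : a * a = _) invgK.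
Qed.

(** By R4, a^-1 c = b^-1 c a^-1, so both sides reduce to c^-1 a^-1. This computes y_{3,0} x_3. *)
Lemma mul_cbaac a b c :
  a ^+ 3 = 1 -> c ^+ 3 = 1 -> (b * c) ^+ 2 = 1 -> a * b^-1 * c = c * a ->
  c * b * a ^+ 2 * c = b * c * b * a ^+ 2.
Proof.
move=> a3 c3 bc2 abc.
have Dac : a^-1 * c = b^-1 * c * a^-1.
  by apply: (mulgI a); apply: (mulIg a); rewrite mulVKg !mulgA mulgVK abc.
rewrite expg2_inv // -(mulgA _ _ c) Dac !mulgA mulgK.
by rewrite (mul_aba bc2) -(expg2_inv c3).
Qed.

End ThreeCycleIdentities.

(** * Cosets of H_{m-1} in H_m *)

Section Cosets.
Variables (G : groupType) (x : nat -> G).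

(** A submonoid suffices: by [x3], inverses of generators are squares. *)
Inductive generated (m : nat) : G -> Prop :=
| generated1 : generated m 1
| generated_gen i : 0 < i <= m -> generated m (x i)
| generatedM g h : generated m g -> generated m h -> generated m (g * h).

Definition desc m k : G := \prod_(i <- rev (index_iota k m.+1)) x i.

Lemma desc_geq m k : m < k -> desc m k = 1.
Proof.
move=> ltmk; rewrite /desc /index_iota.
by have -> : (m.+1 - k = 0)%N; [lia | rewrite big_nil].
Qed.

Lemma descSl m k : k <= m.+1 -> desc m.+1 k = x m.+1 * desc m k.
Proof.
move=> lekm; rewrite /desc /index_iota subSn // -addn1 iotaD /=.
by rewrite subnKC // rev_cat big_cons.
Qed.

Lemma descSr m k : k <= m -> desc m k = desc m k.+1 * x k.
Proof.
move=> lekm; rewrite /desc /index_iota subSS subSn // /= rev_cons.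
by rewrite -cats1 big_cat big_seq1.
Qed.

Definition y m k : G := if k == 0 then desc m 2 * x 1 ^+ 2 else desc m k.

Variable N : nat.
(** In the application [x] is 1 outside 1..N, so R1 and R3 can be asked of all indices. R2 and R4
    cannot: at i = N, R2 would give x_N^2 = 1. *)
Hypothesis x3 : forall i, x i ^+ 3 = 1.
Hypothesis xx2 : forall i, 0 < i < N -> (x i * x i.+1) ^+ 2 = 1.
Hypothesis xC : forall i j, i.+2 < j -> x i * x j = x j * x i.
Hypothesis xVx :
  forall i, 0 < i < N.-1 -> x i * (x i.+1)^-1 * x i.+2 = x i.+2 * x i.

Lemma generatedV m g : generated m g -> generated m g^-1.
Proof.
elim=> [|i lei|h k _ Hh _ Hk]; first by rewrite invg1; apply: generated1.
  by rewrite -expg2_inv //; apply: generatedM; apply: generated_gen.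
by rewrite invgM; apply: generatedM.
Qed.

Lemma generated_conj_x m g : m.+1 <= N -> generated m.-1 g ->
  exists2 h, generated m h & x m.+1 * g = h * x m.+1.
Proof.
move=> lemN; elim=> [|i lei|g1 g2 _ [h1 Hh1 E1] _ [h2 Hh2 E2]].
- by exists 1; [apply: generated1 | rewrite mulg1 mul1g].
- have [ltim|leim] := ltnP i.+1 m.
    by exists (x i); [apply: generated_gen; lia | rewrite -xC].
  (* Only i = m - 1 is left, where R4 gives the conjugate. *)
  exists (x i * (x m)^-1).
    by apply: generatedM; [|apply: generatedV]; apply: generated_gen; lia.
  have -> : m = i.+1 by lia.
  by rewrite xVx //; lia.
exists (h1 * h2); first exact: generatedM.
by rewrite mulgA E1 -mulgA E2 mulgA.
Qed.

Lemma generated_conj_desc m k g : k < m -> m <= N -> generated k g ->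
  exists2 h, generated m.-1 h & desc m k.+2 * g = h * desc m k.+2.
Proof.
move=> ltkm; elim: m ltkm => // m IHm; rewrite ltnS leq_eqVlt.
case/predU1P=> [-> _ Hg|ltkm lemN Hg].
  (* For m = k + 1 the product is empty and H_k is already H_{m-1}. *)
  by exists g; rewrite // desc_geq // mulg1 mul1g.
have [h Hh E] := IHm ltkm (ltnW lemN) Hg.
have [h' Hh' E'] := generated_conj_x lemN Hh.
by exists h'; rewrite // descSl // -mulgA E !mulgA E'.
Qed.

Lemma desc_commute m k i : m.+2 < i -> desc m k * x i = x i * desc m k.
Proof.
move=> lti; rewrite /desc big_seq; elim/big_ind: _ => [|g h Hg Hh|j].
- by rewrite mulg1 mul1g.
- by rewrite -mulgA Hh mulgA Hg mulgA.
by rewrite mem_rev mem_index_iota => lej; rewrite xC //; lia.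
Qed.

Lemma desc_cat m p k : k <= p.+1 -> p <= m -> desc m k = desc m p.+1 * desc p k.
Proof.
move=> lekp lepm; rewrite /desc -big_cat -rev_cat /index_iota.
congr (\prod_(i <- rev _) _); rewrite -{2}(subnKC lekp) -iotaD.
by congr iota; lia.
Qed.

Lemma y_cat m p k : k <= p.+1 -> 0 < p <= m -> y m k = desc m p.+1 * y p k.
Proof.
move=> lekp lepm; rewrite /y; case: ifP => _.
  by rewrite (@desc_cat m p) ?mulgA //; lia.
by apply: desc_cat => //; lia.
Qed.

(** The case m = i of k < i - 1; larger m will follow by conjugation with x_m ... x_{i+1}. *)
Lemma coset_top_fixed i k : i <= N -> k.+1 < i -> 1 < i ->
  exists2 h, generated i.-1 h & y i k * x i = h * y i k.
Proof.
(* The tail x_p ... x_j commutes with [x p.+3] by R3; [mul_cbac] handles the three top factors. *)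
have fixed p j : p.+3 <= N -> 0 < j <= p.+1 ->
    desc p.+3 j * x p.+3 = x p.+1 * desc p.+3 j.
  move=> lepN lej; rewrite (@desc_cat p.+3 p) //; try lia.
  rewrite -mulgA desc_commute // !mulgA; congr (_ * _).
  have -> : desc p.+3 p.+1 = x p.+3 * x p.+2 * x p.+1.
    by rewrite !descSl ?desc_geq ?mulg1 ?mulgA //; lia.
  by rewrite mul_cbac ?xx2 ?xVx ?mulgA //; lia.
rewrite /y; case: k => [|k] leiN ltki lt1i /=.
  (* For k = 0, x_i commutes with the final x_1^2 only from i = 4 on, where [fixed] applies with j =
     2; i = 2 and i = 3 need their own identities. *)
  case: i leiN {ltki} lt1i => [|[|[|[|i]]]] // leiN _.
  - exists (x 1)^-1; first by apply/generatedV/generated_gen.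
    by rewrite descSl // desc_geq // mulg1 mul_baab ?mulgA // xx2.
  - exists (x 2); first by apply: generated_gen.
    rewrite descSl // descSl // desc_geq // mulg1.
    by rewrite mul_cbaac ?xx2 ?xVx ?mulgA //; lia.
  exists (x i.+2); first by apply: generated_gen; lia.
  have C1 : x 1 * x i.+4 = x i.+4 * x 1 by rewrite xC.
  rewrite -mulgA expgS expg1 -[_ * x i.+4]mulgA C1 !mulgA.
  by rewrite -(mulgA _ (x 1)) C1 !mulgA fixed //; lia.
case: i leiN ltki {lt1i} => [|[|[|i]]] // leiN ltki.
exists (x i.+1); first by apply: generated_gen; lia.
by rewrite fixed //; lia.
Qed.

Lemma coset_y m i k : m <= N -> 0 < i <= m -> k <= m.+1 ->
  exists2 h, generated m.-1 h &
    exists2 k', k' <= m.+1 & y m k * x i = h * y m k'.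
Proof.
move=> lemN lei lekm.
have conj j g : j < m -> generated j g ->
    exists2 h, generated m.-1 h & desc m j.+2 * g = h * desc m j.+2.
  by move=> ltjm; apply: generated_conj_desc.
(* If k > i + 1, then x_i lies in H_{k-2}, which y_{m,k} conjugates into H_{m-1}. *)
have [ltik|leki] := ltnP i.+1 k.
  case: k ltik lekm => [|[|k]] // ltik lekm.
  have [||h Hh E] := conj k (x i); [lia | by apply: generated_gen; lia |].
  by exists h => //; exists k.+2.
have [ltki|leik] := ltnP k.+1 i.
  have [|||h Hh E] := @coset_top_fixed i k; try lia.
  have [||h' Hh' E'] := conj i.-1 h; [lia | done |].
  exists h' => //; exists k => //.
  have Di : i.-1.+2 = i.+1 by lia.
  rewrite (@y_cat m i); try lia.
  by rewrite -mulgA E !mulgA -Di E'.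
have Ey : y m i.+1 * x i = y m i.
  rewrite /y /= -descSr; last lia.
  by case: eqP => //; lia.
(* If i = 1, x_1^2 is the tail of y_{m,0}. Otherwise x_i^2 = x_i^-1 = x_{i-1} x_i x_{i-1}: the first
   factor moves left into H_{m-1}, the others complete y_{m,i-1}. *)
have stepi : exists2 h, generated m.-1 h & y m i * x i = h * y m i.-1.
  case: i {leki leik Ey} lei => [|[|i]] // lei.
    exists 1; first exact: generated1.
    rewrite mul1g /y /= (@descSr m 1); last lia.
    by rewrite expgS expg1 mulgA.
  have [||h Hh E] := conj i.+1 (x i.+1); [lia | by apply: generated_gen; lia|].
  exists h => //; rewrite /y /= (@descSr m i.+1); last lia.
  rewrite (@descSr m i.+2); last lia.
  rewrite -mulgA -[x _ * x _](expgS _ 1) expg2_inv //.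
  rewrite -(mul_aba (xx2 _)); last lia.
  by rewrite !mulgA E.
have [-> | [-> | ->]] : k = i.+1 \/ k = i \/ k = i.-1 by lia.
- exists 1; first exact: generated1.
  by exists i; [lia | rewrite mul1g].
- by have [h Hh E] := stepi; exists h => //; exists i.-1 => //; lia.
(* Here h y_{m,i-1} x_i = y_{m,i} x_i^2 = y_{m,i+1} x_i^3 = y_{m,i+1}. *)
have [h Hh E] := stepi; exists h^-1; first exact: generatedV.
exists i.+1; first lia.
apply: (mulgI h); rewrite mulVKg mulgA -E -Ey -!mulgA.
by have := x3 i; rewrite !expgS expg0 mulg1 => ->; rewrite mulg1.
Qed.

Lemma generated_normal_form m g : m <= N -> generated m g ->
  exists k : nat -> nat,
    (forall j, 1 <= j <= m -> k j <= j.+1) /\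
    g = \prod_(1 <= j < m.+1) y j (k j).
Proof.
elim: m g => [|m IHm] g lemN Hg.
  exists id; split=> [j|]; first by lia.
  rewrite big_geq //; elim: Hg => [|i|_ _ _ -> _ ->] //; last by rewrite mulg1.
  by lia.
have [h Hh [k' lek' ->]] : exists2 h, generated m h &
    exists2 k', k' <= m.+2 & g = h * y m.+1 k'.
  rewrite -(mul1g g).
  have [h Hh [k' lek' E]] : exists2 h, generated m h &
      exists2 k', k' <= m.+2 & 1 = h * y m.+1 k'.
    exists 1; first exact: generated1.
    by exists m.+2; rewrite // mul1g /y /= desc_geq.
  (* The starting point 1 = 1 * y_{m+1,m+2} is generalized to any h y_{m+1,k'}, so that the
     induction on g can chain products. *)
  rewrite {}E; elim: Hg h k' Hh lek' => [|i lei|g1 g2 _ IH1 _ IH2] h k' Hh lek'.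
  - by exists h => //; exists k'; rewrite ?mulg1.
  - have [h' Hh' [k1 lek1 E]] := coset_y lemN lei lek'.
    exists (h * h'); first exact: generatedM.
    by exists k1; rewrite // -mulgA E mulgA.
  have [h1 Hh1 [k1 lek1 E1]] := IH1 h k' Hh lek'.
  have [h2 Hh2 [k2 lek2 E2]] := IH2 h1 k1 Hh1 lek1.
  by exists h2 => //; exists k2; rewrite // mulgA E1 E2.
have [k [lek ->]] := IHm h (ltnW lemN) Hh.
exists (fun j => if j == m.+1 then k' else k j); split=> [j lej|].
  by case: eqP => [->|nej] //; apply: lek; lia.
rewrite [RHS]big_nat_recr //= eqxx; congr (_ * _).
by apply: eq_big_nat => j ltj; case: eqP => // Ej; lia.
Qed.

End Cosets.

(** * The defining relations transferred to [x_ n] *)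

Lemma x_valE n (t : gen n) : x_ n (val t) = pgen (@S_plus_rel n) t.
Proof. by rewrite /x_ valK. Qed.

Lemma x_out n i : ~~ (0 < i <= n - 2) -> x_ n i = 1.
Proof. by move=> outi; rewrite /x_ insubN. Qed.

Lemma x_in n i : 0 < i <= n - 2 ->
  exists2 t : gen n, val t = i & x_ n i = pgen (@S_plus_rel n) t.
Proof. by move=> ini; exists (Sub i ini); rewrite ?SubK // -x_valE SubK. Qed.

Lemma pclassM n (u v : word (gen n)) :
  pclass (@S_plus_rel n) u * pclass (@S_plus_rel n) v =
  pclass (@S_plus_rel n) (u ++ v) :> S_plus n.
Proof. exact: pmul_pclass. Qed.

Lemma pclassV n (u : word (gen n)) :
  (pclass (@S_plus_rel n) u : S_plus n)^-1 =
  pclass (@S_plus_rel n) (inv_word u).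
Proof. exact: pinv_pclass. Qed.

Lemma rel_eq n (u v : word (gen n)) : S_plus_rel u v ->
  pclass (@S_plus_rel n) u = pclass (@S_plus_rel n) v :> S_plus n.
Proof. by move=> uv; apply/pclassP/pcongr_rel. Qed.

Lemma x_cube n i : x_ n i ^+ 3 = 1.
Proof.
have [/x_in [t _ ->]|/x_out ->] := boolP (0 < i <= n - 2); last exact: expg1n.
have := rel_eq (S_plus_R1 t); rewrite -!pclassM => E.
by rewrite !expgS expg0 mulg1.
Qed.

Lemma x_R2 n i : 0 < i < n - 2 -> (x_ n i * x_ n i.+1) ^+ 2 = 1.
Proof.
move=> lti; have [|s Es ->] := @x_in n i; first lia.
have [|t Et ->] := @x_in n i.+1; first lia.
have Dt : val t = val s + 1 by rewrite Es Et addn1.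
have := rel_eq (S_plus_R2 Dt); rewrite -!pclassM => E.
by rewrite expgS expg1 -mulgA.
Qed.

Lemma x_R3 n i j : i.+2 < j -> x_ n i * x_ n j = x_ n j * x_ n i.
Proof.
have [/x_in [s Es ->]|/x_out ->] := boolP (0 < i <= n - 2); last first.
  by rewrite mulg1 mul1g.
have [/x_in [t Et ->]|/x_out ->] := boolP (0 < j <= n - 2); last first.
  by rewrite mulg1 mul1g.
move=> ltij; have /S_plus_R3/rel_eq : 2 < val s - val t \/ 2 < val t - val s.
  by rewrite Es Et; lia.
by rewrite -!pclassM.
Qed.

Lemma x_R4 n i : 0 < i < (n - 2).-1 ->
  x_ n i * (x_ n i.+1)^-1 * x_ n i.+2 = x_ n i.+2 * x_ n i.
Proof.
move=> lti; have [|s Es ->] := @x_in n i; first lia.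
have [|t Et ->] := @x_in n i.+1; first lia.
have [|u Eu ->] := @x_in n i.+2; first lia.
have Dt : val t = val s + 1 by rewrite Es Et addn1.
have Du : val u = val s + 2 by rewrite Es Eu addn2.
by have := rel_eq (S_plus_R4 Dt Du); rewrite -!pclassM -pclassV mulgA.
Qed.

Lemma generated_S_plus n (X : S_plus n) : generated (x_ n) (n - 2) X.
Proof.
have [w ->] := pclass_surj X.
elim: w => [|[t b] w IHw]; first exact: generated1.
rewrite -cat1s -pclassM; apply: generatedM IHw.
have Ht : generated (x_ n) (n - 2) (pgen (@S_plus_rel n) t).
  by rewrite -x_valE; apply: generated_gen; apply: (valP t).
case: b => //; have := generatedV (x_cube n) Ht.
by rewrite /pgen pclassV.
Qed.

(** * Formal products and counts of appearances *)

Lemma form_value_descending n m k :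
  form_value n (descending m k) = desc (x_ n) m k.
Proof.
rewrite /form_value /descending big_map.
by apply: eq_bigr => i _; rewrite expg1.
Qed.

Lemma y_desc n m k : y_ n m k = y (x_ n) m k.
Proof.
rewrite /y_ /y_form /y -!form_value_descending; case: ifP => // _.
by rewrite /form_value big_cat big_seq1.
Qed.

Lemma appearances_descending i m k :
  appearances i (descending m k) = (k <= i <= m).
Proof.
rewrite /appearances /descending count_map count_rev.
rewrite (@eq_count _ _ (pred1 i)) // count_uniq_mem ?iota_uniq //.
by rewrite mem_index_iota.
Qed.

(** No index repeats within one y_{m,k}: the factor x_1^2 is a single entry, placed after x_m ...
    x_2. *)
Lemma appearances_y_form i m k :
  0 < i -> 0 < m -> appearances i (y_form m k) <= (i <= m).
Proof.
move=> i_gt0 m_gt0; rewrite /y_form; case: eqP => [_|/eqP k_neq0].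
  rewrite /appearances count_cat -/(appearances _ _) appearances_descending /=.
  lia.
rewrite appearances_descending; lia.
Qed.

(** Only the blocks y_j with i <= j <= n - 2 can contain x_i, once each. For i = n - l the bound is
    l - 1. *)
Lemma appearances_normal_form n k i :
  0 < i < n -> appearances i (normal_form n k) <= n - 1 - i.
Proof.
move=> lti; rewrite /normal_form /appearances.
rewrite count_flatten -map_comp sumnE big_map.
apply: (@leq_trans (\sum_(1 <= j < n - 1) (i <= j))%N).
  rewrite big_nat [X in _ <= X]big_nat; apply: leq_sum => j ltj.
  by apply: appearances_y_form; lia.
rewrite (@big_cat_nat _ _ _ i) /=; try lia.
rewrite big_nat big1 => [|j ltj]; last lia.
rewrite add0n -[X in _ <= X]muln1 -sum_nat_const_nat.
by apply: leq_sum => j _; apply: leq_b1.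
Qed.

Theorem theorem3 (n : nat) (hn : 3 <= n) (X : S_plus n) :
  exists k : nat -> nat,
    [/\ forall j, 1 <= j <= n - 2 -> 0 <= k j <= j + 1,
        X = (\prod_(1 <= j < n - 1) y_ n j (k j))%g,
        appearances (n - 2) (normal_form n k) <= 1
      & forall l, 2 <= l <= n - 1 ->
          appearances (n - l) (normal_form n k) <= l - 1].
Proof.
have [k [lek ->]] := generated_normal_form (x_cube n) (@x_R2 n) (@x_R3 n)
  (@x_R4 n) (leqnn _) (generated_S_plus X).
exists k; split=> [j lej|||l lel].
- by rewrite addn1; apply: lek.
- have <- : (n - 2).+1 = n - 1 by lia.
  by apply: eq_bigr => j _; rewrite y_desc.
- by apply: leq_trans (appearances_normal_form k _) _; lia.
by apply: leq_trans (appearances_normal_form k _) _; lia.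
Qed.
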